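(* For a finite word $w$ over an alphabet $\Sigma$, $SP(w)=|w|$ if and only if $w$ is a block word.
   Context: A word $u$ is a scattered subword of $w$ if $u$ is a (not necessarily contiguous) subsequence of $w$. A palindrome is a word equal to its reversal. $SP(w)$ denotes the number of distinct non-empty palindromes that are scattered subwords of $w$, and $|w|$ is the length of $w$. A word $w$ is a block word if $w=a_1^{n_1}a_2^{n_2}\cdots a_r^{n_r}$ where the letters $a_1,\dots,a_r\in\Sigma$ are pairwise distinct and $n_i\ge 1$. *)

(* Defs.v *)
From mathcomp Require Import all_boot.

Set Implicit Arguments.
Unset Strict Implicit.
Unset Printing Implicit Defensive.

Section Words.

Variable Sigma : eqType.
Implicit Types u w : seq Sigma.

Definition palindrome u : bool := rev u == u.

(* [subseq u w] holds iff u = mask m w for some m of size [size w], so the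
   inner sequence lists all the scattered subwords of w, with repetitions;
   see [mem_scattered_palindromes] for the resulting specification. *)
Definition scattered_palindromes w : seq (seq Sigma) :=
  undup [seq u <- [seq mask (val m) w | m : (size w).-tuple bool]
           | (u != [::]) && palindrome u].

Definition SP w : nat := size (scattered_palindromes w).

Lemma scattered_palindromes_uniq w : uniq (scattered_palindromes w).
Proof. exact: undup_uniq. Qed.

Lemma mem_scattered_palindromes w u :
  (u \in scattered_palindromes w) = [&& subseq u w, u != [::] & palindrome u].
Proof.
rewrite mem_undup mem_filter andbC; congr andb.
apply/mapP/subseqP => [[m _ ->]|[m size_m ->]].
  by exists (val m); rewrite // size_tuple.
have size_mP : size m == size w by apply/eqP.
by exists (Tuple size_mP); rewrite // mem_enum.
Qed.

(* The word a_1^{n_1} ... a_r^{n_r} is encoded by [:: (a_1, n_1); ...; (a_r, n_r)].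
   The case r = 0 is allowed: the empty word is a block word. *)
Definition block_word w : Prop :=
  exists s : seq (Sigma * nat),
    [/\ uniq [seq p.1 | p <- s],
        (forall p, p \in s -> 1 <= p.2)
      & w = flatten [seq nseq p.2 p.1 | p <- s]].

End Words.

(* Main.v *)
(* The words a^k with a in w and 1 <= k <= |w|_a are |w| distinct palindromic
   scattered subwords of w, so SP(w) = |w| holds iff there are no others. A
   palindrome which is not a power of a letter has a scattered subword aba
   with a <> b, so this happens iff w has no such scattered subword, which
   characterises block words. *)
Require Import Defs.
From mathcomp Require Import all_boot.

Set Implicit Arguments.
Unset Strict Implicit.
Unset Printing Implicit Defensive.

Section PalindromicSubwords.

Variable Sigma : eqType.
Implicit Types (a b x : Sigma) (u w : seq Sigma).

Definition letter_powers w : seq (seq Sigma) :=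
  [seq nseq k.+1 a | a <- undup w, k <- iota 0 (count_mem a w)].

Definition aba_free w := forall a b, subseq [:: a; b; a] w -> a = b.

Lemma aba_free_subseq u w : subseq u w -> aba_free w -> aba_free u.
Proof. by move=> suw fw a b /subseq_trans /(_ suw); apply: fw. Qed.

Lemma letter_powersP w u :
  reflect (exists a k, k < count_mem a w /\ u = nseq k.+1 a)
          (u \in letter_powers w).
Proof.
apply: (iffP allpairsPdep) => [[a [k [_ + ->]]]|[a [k [ltk ->]]]].
  by rewrite mem_iota; exists a, k.
exists a, k; split=> //; last by rewrite mem_iota.
by rewrite mem_undup -has_pred1 has_count (leq_trans _ ltk).
Qed.

Lemma letter_powers_uniq w : uniq (letter_powers w).
Proof.
apply: allpairs_uniq_dep => [|a _|[a k] [b l] _ _ /= [-> eq_kl]].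
- exact: undup_uniq.
- exact: iota_uniq.
- by have := congr1 size eq_kl; rewrite !size_nseq => ->.
Qed.

(** Each letter [a] contributes [count_mem a w] powers, and repeating every letter of [undup w] that
    many times gives a permutation of [w]. *)
Lemma size_letter_powers w : size (letter_powers w) = size w.
Proof.
rewrite size_allpairs_dep -[RHS](perm_size (perm_count_undup w)) size_flatten.
congr sumn; rewrite /shape -map_comp.
by apply: eq_map => a /=; rewrite size_iota size_nseq.
Qed.

Lemma subseq_nseq_count a k w : k <= count_mem a w -> subseq (nseq k a) w.
Proof.
elim: w k => [|x w IHw] [|k] //=; case: eqVneq => _ /=; first exact: IHw.
exact: (IHw k.+1).
Qed.

Lemma letter_powers_sub w :
  {subset letter_powers w <= scattered_palindromes w}.
Proof.
move=> u /letter_powersP[a [k [ltk ->]]].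
by rewrite mem_scattered_palindromes subseq_nseq_count // /palindrome rev_nseq eqxx.
Qed.

(** The first and last letters of a palindrome agree, so any letter [b] strictly between them yields
    a subword [[:: a; b; a]], which forces [b = a]. *)
Lemma aba_free_palindrome u :
  palindrome u -> aba_free u -> u != [::] ->
  exists a k, u = nseq k.+1 a.
Proof.
case: u => // a u /eqP pal_u free_u _; exists a, (size u).
congr cons; apply/all_pred1P.
case/lastP: u pal_u free_u => [|u c] //.
rewrite rev_cons rev_rcons rcons_cons => -[ca _]; rewrite {c}ca => free_u.
rewrite all_rcons /= eqxx; apply/allP => b b_u /=.
rewrite (free_u a b) //= ?eqxx // -cats1.
by apply: (@cat_subseq _ [:: b] [:: a]); rewrite sub1seq ?mem_head.
Qed.

Lemma SP_aba_free w : SP w = size w <-> aba_free w.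
Proof.
split=> [SPw a b sub_w | free_w].
  (* A duplicate-free list included in another that is no longer has the same members, so every
     palindromic subword is a letter power. *)
  have [|_ eqm] := uniq_min_size (letter_powers_uniq w) (@letter_powers_sub w).
    by rewrite size_letter_powers -SPw.
  have : [:: a; b; a] \in scattered_palindromes w.
    by rewrite mem_scattered_palindromes sub_w /= /palindrome.
  by rewrite -eqm => /letter_powersP[c [[|[|k]] [_ // [-> -> _]]]].
rewrite -size_letter_powers /SP; apply/perm_size/uniq_perm.
- exact: scattered_palindromes_uniq.
- exact: letter_powers_uniq.
move=> u; apply/idP/idP; last exact: letter_powers_sub.
rewrite mem_scattered_palindromes => /and3P[sub_u u0 pal_u].
have [a [k def_u]] :=
  aba_free_palindrome pal_u (aba_free_subseq sub_u free_w) u0.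
apply/letter_powersP; exists a, k; split=> //.
(* The exponent is bounded because passing to a subword cannot increase the number of occurrences of
   [a]. *)
have := leq_count_subseq (pred1 a) sub_u.
by rewrite {1}def_u count_nseq /= eqxx mul1n.
Qed.

(** Induction on [w]: a new first letter opens a block of its own, while one already present must
    extend the first block. *)
Lemma aba_free_block_word w : aba_free w -> block_word w.
Proof.
elim: w => [|a w IHw] free_aw; first by exists [::].
have [s [uniq_s pos_s def_w]] :=
  IHw (aba_free_subseq (subseq_cons w a) free_aw).
have [a_s | aNs] := boolP (a \in [seq p.1 | p <- s]); last first.
  exists ((a, 1) :: s); split=> [|p|] /=; rewrite ?aNs ?def_w //.
  by rewrite in_cons => /predU1P[-> // | /pos_s].
case: s uniq_s pos_s def_w a_s => // -[b n] s uniq_s pos_s def_w a_s.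
have n_gt0 : 0 < n := pos_s _ (mem_head _ _).
have a_w : a \in w.
  have /mapP[p ps ->] := a_s.
  rewrite def_w; apply/flatten_mapP; exists p => //.
  by rewrite mem_nseq eqxx pos_s.
have ab : a = b.
  (* As [n] is positive, [w] starts with [b]; if [a] differed from [b], it would recur after that
     [b], giving the subword [[:: a; b; a]]. *)
  case: n n_gt0 def_w {pos_s uniq_s a_s} => //= n _ def_w.
  have [//|neq_ab] := eqVneq a b; apply: free_aw; rewrite def_w /= !eqxx.
  by move: a_w; rewrite def_w in_cons (negPf neq_ab) -sub1seq.
exists ((b, n.+1) :: s); split=> // [p|]; last by rewrite ab def_w.
by rewrite in_cons => /predU1P[-> // | ps]; apply: pos_s; rewrite in_cons ps orbT.
Qed.

Lemma subseq_cons_nseq_cat a x n u w :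
  a != x -> subseq (a :: u) (nseq n x ++ w) -> subseq (a :: u) w.
Proof. by move=> /negPf neq_ax; elim: n => //= n IHn; rewrite neq_ax. Qed.

Lemma aba_free_nseq_cat x n w :
  x \notin w -> aba_free w -> aba_free (nseq n x ++ w).
Proof.
move=> xNw free_w a b; have [->|neq_ax] := eqVneq a x; last first.
  by move/(subseq_cons_nseq_cat neq_ax)/free_w.
have [-> // | neq_bx] := eqVneq b x.
(* Here [a] is [x]: the tail [[:: b; x]] cannot start inside the block, so it embeds in [w],
   contradicting [x \notin w]. *)
move=> /(subseq_trans (subseq_cons _ _)) /(subseq_cons_nseq_cat neq_bx).
by move/mem_subseq/(_ x); rewrite !inE eqxx orbT (negPf xNw) => /(_ isT).
Qed.

Lemma block_word_aba_free w : block_word w -> aba_free w.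
Proof.
case=> s [+ _ ->]; elim: s => [|[x n] s IHs] //= /andP[xNs /IHs free_s].
(* Distinctness of the block letters keeps [x] out of all later blocks. *)
apply: aba_free_nseq_cat => //; apply: contra xNs => /flatten_mapP[p ps].
by rewrite mem_nseq => /andP[_ /eqP ->]; apply: map_f.
Qed.

End PalindromicSubwords.

Theorem theorem3p6 (Sigma : eqType) (w : seq Sigma) :
  SP w = size w <-> block_word w.
Proof.
split=> [/SP_aba_free | /block_word_aba_free free_w].
  exact: aba_free_block_word.
exact/SP_aba_free.
Qed.
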